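(* Let $\mathbb K$ be an algebraically closed field of characteristic zero, let $V$ be a finite-dimensional $\mathfrak{sl}_2(\mathbb K)$-module and let $s$ be the operator defined in the context. Then: (i) there exists an $\mathcal A$-module structure on $V$ for which $x,y,z$ act as $X$, $sY$, $-\mathbf i sZ$ respectively; (ii) there exists an $\mathcal A$-module structure on $V$ for which $x,y,z$ act as $X$, $-sY$, $\mathbf i sZ$ respectively.
   Context: Let $\mathbf i\in\mathbb K$ with $\mathbf i^2=-1$. $\mathfrak{sl}_2(\mathbb K)$ is the Lie algebra with basis $X,Y,Z$ and bracket $[X,Y]=2\mathbf iZ$, $[Y,Z]=2\mathbf iX$, $[Z,X]=2\mathbf iY$. On every finite-dimensional $\mathfrak{sl}_2(\mathbb K)$-module, $N_\pm=\tfrac12(\mathbf iY\pm X)$ act nilpotently; define $h=\exp(N_-)\exp(N_+)\exp(N_-)$. Let $k$ act as $1$ on each odd-dimensional irreducible submodule and as $-\mathbf i$ on each even-dimensional irreducible submodule. Set $s=hk$. $\mathcal A$ is the unital associative $\mathbb K$-algebra with generators $x,y,z$ and relations $xy+yx=2z$, $yz+zy=2x$, $zx+xz=2y$. *)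

(* Defs.v *)
From HB Require Import structures.
From mathcomp Require Import all_boot all_order all_algebra.
From mathcomp Require Import boolp classical_sets.

Set Implicit Arguments.
Unset Strict Implicit.
Unset Printing Implicit Defensive.

Import GRing.Theory.
Local Open Scope ring_scope.

(* sl_2(K), as the space of coordinate vectors in the basis X, Y, Z.  In these
   coordinates the bracket determined by [X,Y] = 2iZ, [Y,Z] = 2iX,
   [Z,X] = 2iY is 2i times the cross product; indices are taken modulo 3. *)
Section Sl2.
Variables (K : fieldType) (i : K).

Definition sl2 := 'rV[K]_3.
HB.instance Definition _ := Vector.on sl2.

Definition sl2X : sl2 := delta_mx 0 0.
Definition sl2Y : sl2 := delta_mx 0 1.
Definition sl2Z : sl2 := delta_mx 0 2%:R.

Definition sl2_bracket (u v : sl2) : sl2 :=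
  \row_(j < 3) (2%:R * i *
    (u 0 (j + 1) * v 0 (j + 2%:R) - u 0 (j + 2%:R) * v 0 (j + 1))).

Lemma sl2_bracketXY : sl2_bracket sl2X sl2Y = (2%:R * i) *: sl2Z.
Proof.
apply/rowP; case; case=> [|[|[|//]]] lt3; rewrite !mxE /=;
  by rewrite ?(mulr0, mul0r, mulr1, subr0, sub0r, oppr0).
Qed.

Lemma sl2_bracketYZ : sl2_bracket sl2Y sl2Z = (2%:R * i) *: sl2X.
Proof.
apply/rowP; case; case=> [|[|[|//]]] lt3; rewrite !mxE /=;
  by rewrite ?(mulr0, mul0r, mulr1, subr0, sub0r, oppr0).
Qed.

Lemma sl2_bracketZX : sl2_bracket sl2Z sl2X = (2%:R * i) *: sl2Y.
Proof.
apply/rowP; case; case=> [|[|[|//]]] lt3; rewrite !mxE /=;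
  by rewrite ?(mulr0, mul0r, mulr1, subr0, sub0r, oppr0).
Qed.

Lemma sl2_bracket_linearl v : linear (sl2_bracket^~ v).
Proof.
move=> a u w; apply/rowP => j; rewrite !mxE.
rewrite [RHS]addrC mulrCA -mulrDr; congr (_ * _).
rewrite !mulrDl mulrBr !mulrA opprD addrACA [RHS]addrC.
by congr (_ + _).
Qed.

Lemma sl2_bracketvv u : sl2_bracket u u = 0.
Proof.
by apply/rowP => j; rewrite !mxE [u 0 (j + 1) * _]mulrC subrr mulr0.
Qed.

End Sl2.

Section Module.
Variables (K : fieldType) (V : vectType K).

Section Representation.
Variables (i : K) (rho : sl2 K -> 'End(V)).

Definition sl2_module : Prop :=
  linear rho /\
  forall u v, rho (sl2_bracket i u v) =
                (rho u \o rho v)%VF - (rho v \o rho u)%VF.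

Definition submodule (U : {vspace V}) : Prop :=
  forall u : sl2 K, (rho u @: U <= U)%VS.

Definition irreducible_submodule (U : {vspace V}) : Prop :=
  [/\ submodule U, U != 0%VS &
      forall W : {vspace V}, submodule W -> (W <= U)%VS ->
        W = 0%VS \/ W = U].

(* The exponential of a nilpotent endomorphism f: since f ^ n = 0 for
   n = \dim V, the exponential series stops before the n-th term. *)
Definition exp_nilp (f : 'End(V)) : 'End(V) :=
  \sum_(j < \dim {:V}) (j`!%:R)^-1 *: iter j (comp_lfun f) \1%VF.

Definition Nplus : 'End(V) := 2%:R^-1 *: (i *: rho (sl2Y K) + rho (sl2X K)).
Definition Nminus : 'End(V) := 2%:R^-1 *: (i *: rho (sl2Y K) - rho (sl2X K)).

Definition h_op : 'End(V) :=
  (exp_nilp Nminus \o exp_nilp Nplus \o exp_nilp Nminus)%VF.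

Definition k_spec (k : 'End(V)) : Prop :=
  forall U : {vspace V}, irreducible_submodule U ->
  forall v, v \in U -> k v = if odd (\dim U) then v else - i *: v.

(* The operator satisfying k_spec.  By complete reducibility there is exactly
   one on an sl_2(K)-module; the default value 0 is never used there. *)
Definition k_op : 'End(V) := xget 0 k_spec.

Definition s_op : 'End(V) := (h_op \o k_op)%VF.

End Representation.

(* A module structure over a unital associative algebra on the vector space V,
   inducing the given scalar multiplication by K. *)
Definition algebra_module (A : algType K) (act : A -> 'End(V)) : Prop :=
  [/\ linear act, act 1 = \1%VF &
      forall a b, act (a * b) = (act a \o act b)%VF].

End Module.

(* The algebra presented by the generators x, y, z and the relations
   xy + yx = 2z, yz + zy = 2x, zx + xz = 2y: noncommutative polynomial
   expressions in x, y, z, modulo the congruence generated by the axioms of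
   unital associative K-algebras and the three relations. *)
Section Presentation.
Variable K : fieldType.

Inductive expr :=
  | Cst of K | Gx | Gy | Gz | Add of expr & expr | Mul of expr & expr.

Inductive cong : expr -> expr -> Prop :=
  | cong_refl a : cong a a
  | cong_sym a b : cong a b -> cong b a
  | cong_trans a b c : cong a b -> cong b c -> cong a c
  | cong_Add a a' b b' : cong a a' -> cong b b' -> cong (Add a b) (Add a' b')
  | cong_Mul a a' b b' : cong a a' -> cong b b' -> cong (Mul a b) (Mul a' b')
  | cong_AddA a b c : cong (Add a (Add b c)) (Add (Add a b) c)
  | cong_AddC a b : cong (Add a b) (Add b a)
  | cong_Add0 a : cong (Add (Cst 0) a) a
  | cong_AddN a : cong (Add (Mul (Cst (- 1)) a) a) (Cst 0)
  | cong_MulA a b c : cong (Mul a (Mul b c)) (Mul (Mul a b) c)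
  | cong_Mul1l a : cong (Mul (Cst 1) a) a
  | cong_Mul1r a : cong (Mul a (Cst 1)) a
  | cong_MulDl a b c : cong (Mul (Add a b) c) (Add (Mul a c) (Mul b c))
  | cong_MulDr a b c : cong (Mul a (Add b c)) (Add (Mul a b) (Mul a c))
  | cong_CstD c d : cong (Cst (c + d)) (Add (Cst c) (Cst d))
  | cong_CstM c d : cong (Cst (c * d)) (Mul (Cst c) (Cst d))
  | cong_CstC c a : cong (Mul (Cst c) a) (Mul a (Cst c))
  | cong_xy : cong (Add (Mul Gx Gy) (Mul Gy Gx)) (Mul (Cst 2%:R) Gz)
  | cong_yz : cong (Add (Mul Gy Gz) (Mul Gz Gy)) (Mul (Cst 2%:R) Gx)
  | cong_zx : cong (Add (Mul Gz Gx) (Mul Gx Gz)) (Mul (Cst 2%:R) Gy).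

HB.instance Definition _ := gen_eqMixin expr.
HB.instance Definition _ := gen_choiceMixin expr.

Definition congb (a b : expr) : bool := `[< cong a b >].

Lemma congb_refl : reflexive congb.
Proof. by move=> a; apply/asboolP/cong_refl. Qed.
Lemma congb_sym : symmetric congb.
Proof. by move=> a b; apply/asboolP/asboolP => /cong_sym. Qed.
Lemma congb_trans : transitive congb.
Proof. by move=> b a c /asboolP ab /asboolP /(cong_trans ab) /asboolP. Qed.

Canonical congb_equiv := EquivRel congb congb_refl congb_sym congb_trans.

Definition algA := {eq_quot congb_equiv}%qT.
HB.instance Definition _ := Choice.on algA.

Definition to_algA (a : expr) : algA := (\pi_algA a)%qT.

Lemma to_algA_cong a b : to_algA a = to_algA b <-> cong a b.
Proof.
split=> [/eqP|cab]; first by rewrite eqmodE => /asboolP.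
by apply/eqP; rewrite eqmodE; apply/asboolP.
Qed.

Lemma repr_to_algA a : cong (repr (to_algA a)) a.
Proof. by apply/to_algA_cong; rewrite /to_algA reprK. Qed.

Lemma algAW (P : algA -> Prop) : (forall a, P (to_algA a)) -> forall q, P q.
Proof. by move=> Pa q; rewrite -[q]reprK; apply: Pa. Qed.

Definition algA_add (p q : algA) := to_algA (Add (repr p) (repr q)).
Definition algA_mul (p q : algA) := to_algA (Mul (repr p) (repr q)).
Definition algA_opp (p : algA) := algA_mul (to_algA (Cst (- 1))) p.
Definition algA_scale (c : K) (p : algA) := algA_mul (to_algA (Cst c)) p.

Lemma to_algA_add a b : algA_add (to_algA a) (to_algA b) = to_algA (Add a b).
Proof. by apply/to_algA_cong/cong_Add; apply: repr_to_algA. Qed.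

Lemma to_algA_mul a b : algA_mul (to_algA a) (to_algA b) = to_algA (Mul a b).
Proof. by apply/to_algA_cong/cong_Mul; apply: repr_to_algA. Qed.

Let toE := (to_algA_add, to_algA_mul).

Lemma algA_addA : associative algA_add.
Proof.
elim/algAW=> a; elim/algAW=> b; elim/algAW=> c.
by rewrite !toE; apply/to_algA_cong/cong_AddA.
Qed.

Lemma algA_addC : commutative algA_add.
Proof.
elim/algAW=> a; elim/algAW=> b.
by rewrite !toE; apply/to_algA_cong/cong_AddC.
Qed.

Lemma algA_add0 : left_id (to_algA (Cst 0)) algA_add.
Proof. by elim/algAW=> a; rewrite !toE; apply/to_algA_cong/cong_Add0. Qed.

Lemma algA_addN : left_inverse (to_algA (Cst 0)) algA_opp algA_add.
Proof.
by elim/algAW=> a; rewrite /algA_opp !toE; apply/to_algA_cong/cong_AddN.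
Qed.

HB.instance Definition _ :=
  GRing.isZmodule.Build algA algA_addA algA_addC algA_add0 algA_addN.

Lemma algA_mulA : associative algA_mul.
Proof.
elim/algAW=> a; elim/algAW=> b; elim/algAW=> c.
by rewrite !toE; apply/to_algA_cong/cong_MulA.
Qed.

Lemma algA_mul1l : left_id (to_algA (Cst 1)) algA_mul.
Proof. by elim/algAW=> a; rewrite !toE; apply/to_algA_cong/cong_Mul1l. Qed.

Lemma algA_mul1r : right_id (to_algA (Cst 1)) algA_mul.
Proof. by elim/algAW=> a; rewrite !toE; apply/to_algA_cong/cong_Mul1r. Qed.

Lemma algA_mulDl : left_distributive algA_mul +%R.
Proof.
elim/algAW=> a; elim/algAW=> b; elim/algAW=> c.
by rewrite /GRing.add /= !toE; apply/to_algA_cong/cong_MulDl.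
Qed.

Lemma algA_mulDr : right_distributive algA_mul +%R.
Proof.
elim/algAW=> a; elim/algAW=> b; elim/algAW=> c.
by rewrite /GRing.add /= !toE; apply/to_algA_cong/cong_MulDr.
Qed.

(* x = y = z = 1 satisfies the relations. *)
Fixpoint augmentation (a : expr) : K :=
  match a with
  | Cst c => c
  | Gx | Gy | Gz => 1
  | Add a b => augmentation a + augmentation b
  | Mul a b => augmentation a * augmentation b
  end.

Lemma augmentation_cong a b : cong a b -> augmentation a = augmentation b.
Proof.
elim=> {a b} /=; do ?[by move=> *; congruence];
  move=> *; rewrite ?(mulN1r, mulr1, mul1r, add0r, addNr) //.
- by rewrite addrA.
- by rewrite addrC.
- by rewrite mulrA.
- by rewrite mulrDl.
- by rewrite mulrDr.
- by rewrite mulrC.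
Qed.

Lemma algA_one_neq0 : to_algA (Cst 1) != 0.
Proof.
by apply/eqP => /to_algA_cong /augmentation_cong /eqP; rewrite oner_eq0.
Qed.

HB.instance Definition _ := GRing.Zmodule_isNzRing.Build algA
  algA_mulA algA_mul1l algA_mul1r algA_mulDl algA_mulDr algA_one_neq0.

Lemma algA_scaleA c d (p : algA) :
  algA_scale c (algA_scale d p) = algA_scale (c * d) p.
Proof.
rewrite /algA_scale algA_mulA to_algA_mul; congr (algA_mul _ _).
exact/esym/to_algA_cong/cong_CstM.
Qed.

Lemma algA_scaleDr : right_distributive algA_scale +%R.
Proof. by move=> c p q; apply: algA_mulDr. Qed.

Lemma algA_scaleDl (p : algA) : {morph algA_scale^~ p : c d / c + d}.
Proof.
move=> c d; rewrite /algA_scale -algA_mulDl; congr (algA_mul _ _).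
by rewrite /GRing.add /= to_algA_add; apply/to_algA_cong/cong_CstD.
Qed.

HB.instance Definition _ := GRing.Zmodule_isLmodule.Build K algA
  algA_scaleA algA_mul1l algA_scaleDr algA_scaleDl.

Lemma algA_scaleAl (c : K) (p q : algA) : c *: (p * q) = c *: p * q.
Proof. exact: algA_mulA. Qed.

HB.instance Definition _ := GRing.Lmodule_isLalgebra.Build K algA algA_scaleAl.

Lemma algA_scaleAr (c : K) (p q : algA) : c *: (p * q) = p * (c *: q).
Proof.
have cC r : c *: r = r * to_algA (Cst c).
  elim/algAW: r => a; rewrite /GRing.scale /GRing.mul /= /algA_scale !toE.
  exact/to_algA_cong/cong_CstC.
by rewrite !cC mulrA.
Qed.

HB.instance Definition _ := GRing.Lalgebra_isAlgebra.Build K algA algA_scaleAr.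

Lemma to_algAD a b : to_algA (Add a b) = to_algA a + to_algA b.
Proof. exact/esym/to_algA_add. Qed.

Lemma to_algAM a b : to_algA (Mul a b) = to_algA a * to_algA b.
Proof. exact/esym/to_algA_mul. Qed.

Lemma to_algAZ c a : to_algA (Mul (Cst c) a) = c *: to_algA a.
Proof. exact/esym/to_algA_mul. Qed.

Definition Ax : algA := to_algA Gx.
Definition Ay : algA := to_algA Gy.
Definition Az : algA := to_algA Gz.

Lemma algA_relations :
  [/\ Ax * Ay + Ay * Ax = 2%:R *: Az, Ay * Az + Az * Ay = 2%:R *: Ax &
      Az * Ax + Ax * Az = 2%:R *: Ay].
Proof.
split; rewrite -?to_algAM -?to_algAD -?to_algAZ; apply/to_algA_cong;
  [exact: cong_xy | exact: cong_yz | exact: cong_zx].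
Qed.

Lemma algA_universal (B : algType K) (x y z : B) :
  x * y + y * x = 2%:R *: z -> y * z + z * y = 2%:R *: x ->
  z * x + x * z = 2%:R *: y ->
  exists! f : algA -> B,
    [/\ linear f, f 1 = 1, {morph f : p q / p * q} &
        [/\ f Ax = x, f Ay = y & f Az = z]].
Proof.
move=> xy yz zx.
pose ev := fix ev (a : expr) : B := match a with
  | Cst c => c%:A | Gx => x | Gy => y | Gz => z
  | Add a b => ev a + ev b | Mul a b => ev a * ev b end.
have evP a b : cong a b -> ev a = ev b.
  elim=> {a b} /=; do ?[by move=> *; congruence];
    move=> *; rewrite ?(mulr_algl, mulr_algr, scaleN1r, scale1r, scale0r,
      add0r, addNr, mulr1, mul1r) //.
  - by rewrite addrA.
  - by rewrite addrC.
  - by rewrite mulrA.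
  - by rewrite mulrDl.
  - by rewrite mulrDr.
  - by rewrite scalerDl.
  - by rewrite scalerA.
pose f (p : algA) := ev (repr p).
have fE a : f (to_algA a) = ev a by apply/evP/repr_to_algA.
exists f; split.
  split; last by split; apply: fE.
  - move=> c; elim/algAW=> a; elim/algAW=> b.
    by rewrite -to_algAZ -to_algAD !fE /= mulr_algl.
  - by rewrite [LHS]fE /= scale1r.
  - by elim/algAW=> a; elim/algAW=> b; rewrite -to_algAM !fE.
move=> g [lin_g g1 gM [gx gy gz]]; apply/funext.
elim/algAW=> a; rewrite fE; elim: a => [c||||a IHa b IHb|a IHa b IHb] //=.
- have -> : to_algA (Cst c) = c *: (1 : algA) + 0.
    rewrite addr0 -[1]/(to_algA (Cst 1)) -to_algAZ.
    exact/esym/to_algA_cong/cong_Mul1r.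
  have g0 : g 0 = 0.
    by have := lin_g (-1) 0 0; rewrite !scaleN1r !addNr.
  by rewrite lin_g g1 g0 addr0.
- by rewrite to_algAD -[to_algA a]scale1r lin_g !scale1r IHa IHb.
- by rewrite to_algAM gM IHa IHb.
Qed.

End Presentation.

(* Main.v *)
(* Put e = N+, f = N-, H = Z; then (e, -f, H) is a standard sl_2-triple. The
   operator h = exp(f) exp(e) exp(f) exchanges e and f under conjugation and
   negates H, so it commutes with Y and anticommutes with X and Z. A vector v
   with e v = 0 and H v = m v satisfies h^2 v = (-1)^m v and generates an
   irreducible submodule with basis v, f v, ..., f^m v; hence h^2 is 1 or -1 on
   an irreducible according as its dimension is odd or even, and k coincides
   there with the polynomial ((1 - i) + (1 + i) h^2) / 2 in h^2.

   These strings span V. On ker e the operator e^j f^j is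
   (-1)^j j! H(H - 1)...(H - j + 1), and it vanishes for large j, so H is
   diagonalizable there with weights in nat. Also V = ker e + im f:
   the ranks of e and f agree because h conjugates one into the other, and
   ker e meets im f trivially because e f u = 0 forces f u = 0. Iterating this
   decomposition gives V = sum_j f^j (ker e), as f is nilpotent.

   Consequently s = h k commutes with Y, anticommutes with X and Z, and
   s^2 = h^4 = 1, which turns the brackets of sl_2 into the relations of A. *)
Require Import Defs.
From mathcomp Require Import all_boot all_order all_algebra.
From mathcomp Require Import boolp classical_sets.
From mathcomp Require Import ring.

Set Implicit Arguments.
Unset Strict Implicit.
Unset Printing Implicit Defensive.

Import GRing.Theory VectorInternalTheory passmx.
Local Open Scope ring_scope.

(** * Nilpotency from a commutator relation *)

Lemma eqr_nat_char0 (K : fieldType) (char0 : [pchar K] =i pred0) (m n : nat) :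
  (m%:R == n%:R :> K) = (m == n).
Proof.
wlog lemn : m n / (m <= n)%N.
  by move=> IH; case/orP: (leq_total m n) => /IH //; rewrite eq_sym [RHS]eq_sym.
have /pcharf0P natf_eq0 := char0; rewrite eq_sym -subr_eq0 -natrB // natf_eq0.
by rewrite subn_eq0 eqn_leq lemn.
Qed.

(* With p the minimal polynomial of A, [B, p(A)] = 2 A p'(A) shows that p
   divides 'X p', hence 'X p' = (deg p) p, which forces p to be a power of 'X.
     *)
Lemma nilpotent_of_commutator (K : fieldType) (char0 : [pchar K] =i pred0)
    (n : nat) (A B : 'M[K]_n.+1) :
  B * A = A * B + A *+ 2 -> A ^+ n.+1 = 0.
Proof.
move=> BA.
have natf_eq0 : forall m, (m%:R == 0 :> K) = (m == 0%N) by exact/pcharf0P.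
have adp (p : {poly K}) : B * horner_mx A p =
    horner_mx A p * B + A * horner_mx A p^`() *+ 2.
  elim/poly_ind: p => [|p c IHp].
    by rewrite deriv0 !rmorph0 !mulr0 !mul0r mul0rn addr0.
  have cA q : GRing.comm A (horner_mx A q) by exact: comm_mx_horner.
  rewrite derivD derivM derivX derivC addr0 mulr1 !rmorphD !rmorphM /=.
  rewrite horner_mx_X horner_mx_C -scalemx1 mulrDr mulrA IHp.
  rewrite !mulrDl -[_ * B * A]mulrA BA !mulrDr -!mulrA -!cA.
  rewrite -scalerAl -scalerAr mul1r mulr1 mulr2n -!addrA; congr (_ + _).
  by rewrite !addrA [LHS](ACl (5*3*1*4*2)).
pose p : {poly K} := mxminpoly A.
have p_monic : p \is monic := mxminpoly_monic A.
have p_neq0 := monic_neq0 p_monic.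
have sp_gt0 : (0 < size p)%N by rewrite size_poly_gt0.
have dvd_p : p %| 'X * p^`().
  apply: mxminpoly_min; rewrite rmorphM /= horner_mx_X.
  have := adp p; rewrite mx_root_minpoly mulr0 mul0r add0r => /esym/eqP.
  by rewrite -scaler_nat scaler_eq0 natf_eq0 /= => /eqP.
have coefXp' j : ('X * p^`())`_j = p`_j *+ j.
  by rewrite coefXM; case: j => //= j; rewrite coef_deriv.
have p_Xn : p = 'X ^+ (size p).-1.
  have [c cE] : exists c, 'X * p^`() = c *: p.
    have: (size ('X * p^`())%R <= size p)%N.
      apply/leq_sizeP => j lej; rewrite coefXp'.
      by rewrite nth_default ?mul0rn.
    have /dvdpP [q ->] := dvd_p.
    have [->|q_neq0] := eqVneq q 0; first by exists 0; rewrite scale0r mul0r.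
    rewrite size_mul // => sz.
    have /size_poly1P[c _ ->] : size q == 1.
      rewrite eqn_leq size_poly_gt0 q_neq0 andbT.
      by move: sz; rewrite -(prednK sp_gt0) addnS /= -add1n leq_add2r.
    by exists c; rewrite mul_polyC.
  (* Coefficientwise, the leading term gives c = deg p; in characteristic zero every other
     coefficient must then vanish. *)
  have coefE' j : p`_j *+ j = c * p`_j by rewrite -coefXp' cE coefZ.
  have pd : p`_((size p).-1) = 1 := monicP p_monic.
  have cd : c = (size p).-1%:R by have := coefE' (size p).-1; rewrite pd mulr1.
  apply/polyP => j; rewrite coefXn.
  have [->|nej] := eqVneq j (size p).-1; first by rewrite pd.
  apply/eqP; have /eqP := coefE' j.
  rewrite cd -[p`_j *+ j]mulr_natl -subr_eq0 -mulrBl mulf_eq0 => /orP[|//].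
  by rewrite subr_eq0 eqr_nat_char0 // (negPf nej).
have : horner_mx A p = 0 := mx_root_minpoly A.
rewrite p_Xn rmorphXn /= horner_mx_X => A0.
have le : ((size p).-1 <= n.+1)%N.
  have := dvdp_leq (monic_neq0 (char_poly_monic A)) (mxminpoly_dvd_char A).
  by rewrite size_char_poly -/p; case: (size p) sp_gt0.
by have := exprD A (size p).-1 (n.+1 - (size p).-1);
  rewrite (subnKC le) A0 mul0r.
Qed.

Lemma nilpotent_endo_of_commutator (K : fieldType) (char0 : [pchar K] =i pred0)
    (V : vectType K) (e H : 'End(V)) :
  (forall x, H (e x) = e (H x) + 2%:R *: e x) ->
  forall x, iter (\dim {:V}) e x = 0.
Proof.
move=> He x; set b := vbasis {:V}.
have bas : basis_of {:V} b := vbasisP _.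
(* Matrices act on row vectors, which reverses composition; the sign in [B] compensates. *)
pose A := mxof b b e; pose B : 'M[K]_(\dim {:V}) := - mxof b b H.
have BA : B *m A = A *m B + A *+ 2.
  have HeE : (H \o e = e \o H + 2%:R *: e)%VF.
    by apply/lfunP => y; rewrite !lfun_simp /= He.
  by rewrite mulNmx mulmxN -!mxof_comp // HeE linearD linearZ /= scaler_nat
    opprD subrK.
have iterE j : rVof b (iter j e x) = iter j (mulmxr A) (rVof b x).
  by elim: j => //= j <-; rewrite (rVof_app b bas).
apply/eqP; rewrite -(rVof_eq0 bas) {}iterE; apply/eqP.
move: (\dim _) A B BA (rVof b x) => {b bas} [|n] A B BA y;
  first by rewrite thinmx0.
have iterE j : iter j (mulmxr A) y = y *m A ^+ j.
  elim: j => [|j IHj]; first by rewrite expr0 mulmx1.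
  by rewrite iterS IHj exprSr /= mulmxA.
by rewrite iterE (nilpotent_of_commutator char0 BA) mulmx0.
Qed.

(** * Exponentials of nilpotent endomorphisms *)

Section Exponential.
Variables (K : fieldType) (V : vectType K).
Hypothesis char0 : [pchar K] =i pred0.
Implicit Types (A B C D : 'End(V)) (x : V).

Let natS_neq0 n : n.+1%:R != 0 :> K.
Proof. by have /pcharf0P -> := char0. Qed.

Lemma iter_lfunD A n : {morph iter n A : x y / x + y}.
Proof. by move=> x y; elim: n => //= n ->; rewrite linearD. Qed.

Lemma iter_lfunZ A n a : {morph iter n A : x / a *: x}.
Proof. by move=> x; elim: n => //= n ->; rewrite linearZ. Qed.

Lemma iter_lfun0 A n : iter n A 0 = 0.
Proof. by elim: n => //= n ->; rewrite linear0. Qed.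

Lemma iter_comp_lfunE A n x : iter n (comp_lfun A) \1%VF x = iter n A x.
Proof. by elim: n => [|n IHn] /=; rewrite ?id_lfunE // comp_lfunE IHn. Qed.

Lemma exp_nilpE A x :
  exp_nilp A x = \sum_(j < \dim {:V}) (j`!%:R)^-1 *: iter j A x.
Proof.
rewrite sum_lfunE; apply: eq_bigr => j _.
by rewrite scale_lfunE iter_comp_lfunE.
Qed.

Section Conjugation.
Variable A : 'End(V).
Hypothesis nilA : forall x, iter (\dim {:V}) A x = 0.

Lemma iter_nilp_eq0 n x : (\dim {:V} <= n)%N -> iter n A x = 0.
Proof. by move=> len; rewrite -(subnK len) iterD nilA iter_lfun0. Qed.

(** Once A^(n + 1) x = 0, applying A^n to exp(A) x = 0 leaves A^n x = 0; this descends from n = dim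
    V to n = 0. *)
Lemma exp_nilp_inj x : exp_nilp A x = 0 -> x = 0.
Proof.
move=> expx; suff nx n : iter n A x = 0 by exact: (nx 0%N).
have [k lek] : exists k, (\dim {:V} <= n + k)%N by exists (\dim {:V});
  rewrite leq_addl.
elim: k n lek => [|k IHk] n lek; first by rewrite iter_nilp_eq0 // -[n]addn0.
have nS j : iter (n + j.+1) A x = 0.
  by rewrite addnS -addSn addnC iterD IHk ?iter_lfun0 // addSnnS.
have [dim0|n_gt0] := posnP (\dim {:V}).
  by apply: iter_nilp_eq0; rewrite dim0.
have := congr1 (iter n A) expx; rewrite iter_lfun0 exp_nilpE.
rewrite (big_morph _ (iter_lfunD A n) (iter_lfun0 A n)).
rewrite -(prednK n_gt0) big_ord_recl big1 => [|j _]; last first.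
  by rewrite iter_lfunZ -iterD nS scaler0.
by rewrite addr0 iter_lfunZ /= invr1 scale1r.
Qed.

Variables B C D : 'End(V).
Hypotheses (ABE : forall x, A (B x) = B (A x) + C x)
  (ACE : forall x, A (C x) = C (A x) + 2%:R *: D x)
  (ADE : forall x, A (D x) = D (A x)).

Let p n x := (n`!%:R)^-1 *: iter n A x.

Let pS n x : p n.+1 x = n.+1%:R^-1 *: A (p n x).
Proof. by rewrite /p linearZ scalerA factS natrM invfM. Qed.

Let ApS n x : A (p n x) = n.+1%:R *: p n.+1 x.
Proof. by rewrite pS scalerA divff ?scale1r. Qed.

Let p_conj n x : p n.+2 (B x) = B (p n.+2 x) + C (p n.+1 x) + D (p n x).
Proof.
elim: n => [|n IHn].
  rewrite /p /= !ABE !linearD /= ACE ABE !linearZ /= invr1 !scale1r !scalerDr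
    !scalerA.
  have -> : 2`!%:R = 2%:R :> K by [].
  rewrite mulVf // scale1r -!addrA; congr (_ + _); rewrite addrA -scalerDl.
  by rewrite -mulr2n -[_^-1 *+ 2]mulr_natl mulfV // scale1r.
apply: (scalerI (natS_neq0 n.+2));
  rewrite -ApS IHn !(linearD A) /= ABE ACE ADE !ApS.
move: (p n.+3 x) (p n.+2 x) (p n.+1 x) => a b c; rewrite !linearZ /=.
move: (B a) (C b) (D c) => u v w; rewrite !scaler_nat !mulrnDl.
rewrite -!addrA; congr (_ + _); rewrite !addrA -mulrS -!addrA; congr (_ + _).
Qed.

Let sum_p_conj n x : \sum_(j < n.+2) p j (B x) =
  B (\sum_(j < n.+2) p j x) + C (\sum_(j < n.+1) p j x) + D (\sum_(j < n) p j
    x).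
Proof.
elim: n => [|n IHn].
  rewrite !big_ord_recr !big_ord0 /= !add0r linear0 addr0 /p /= !invr1 !scale1r.
  by rewrite ABE linearD addrA.
rewrite big_ord_recr IHn /= p_conj.
have sumS (F : 'End(V)) m : F (\sum_(j < m.+1) p j x) =
    F (\sum_(j < m) p j x) + F (p m x) by rewrite big_ord_recr linearD.
by rewrite (sumS B n.+2) (sumS C n.+1) (sumS D n) [RHS](AC (2*2*2)
  ((1*3*5)*(2*4*6))).
Qed.

(** This is exp(A) B exp(-A) = exp(ad A) B: C = [A, B], and D = [A, C] / 2 commutes with A, so the
    series of ad A stops at D. *)
Lemma exp_nilp_conj x :
  exp_nilp A (B x) = B (exp_nilp A x) + C (exp_nilp A x) + D (exp_nilp A x).
Proof.
have expE n y : (\dim {:V} <= n)%N -> exp_nilp A y = \sum_(j < n) p j y.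
  move=> len; rewrite exp_nilpE -(subnKC len) big_split_ord /=.
  rewrite [X in _ + X]big1 ?addr0 // => j _.
  by rewrite /p iter_nilp_eq0 ?scaler0 // leq_addr.
(* The three truncations differ in length, but any length from dim V on gives the exponential. *)
rewrite (expE (\dim {:V}).+2) ?sum_p_conj; last by rewrite !leqW.
by rewrite -!expE // !leqW.
Qed.

End Conjugation.
End Exponential.

(** * Weights *)

Section Triple.
Variables (K : fieldType) (V : vectType K).
Hypothesis char0 : [pchar K] =i pred0.
Implicit Types (e f H g : 'End(V)) (x v u : V).

Let natf_eq0 : forall n, (n%:R == 0 :> K) = (n == 0%N).
Proof. exact/pcharf0P. Qed.

(* The signs are those of N+, N- and Z; the standard triple is (e, -f, H).
   They make the relations invariant under (e, f, H) |-> (f, e, -H). *)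
Definition sl2_triple e f H : Prop :=
  [/\ forall x, f (e x) = e (f x) + H x,
      forall x, H (e x) = e (H x) + 2%:R *: e x &
      forall x, H (f x) = f (H x) - 2%:R *: f x].

Lemma sl2_triple_sym e f H : sl2_triple e f H -> sl2_triple f e (- H).
Proof.
case=> fe He Hf; split=> x; rewrite !opp_lfunE ?fe ?He ?Hf ?addrK //.
  by rewrite opprB linearN addrC.
by rewrite opprD linearN.
Qed.

Lemma sl2_triple_nilp e f H :
  sl2_triple e f H -> forall x, iter (\dim {:V}) e x = 0.
Proof. by case=> _ He _; apply: nilpotent_endo_of_commutator He. Qed.

Lemma iter_weight e f H j x : sl2_triple e f H ->
  H (iter j e x) = iter j e (H x) + (j.*2)%:R *: iter j e x.
Proof.
case=> _ He _; elim: j => [|j IHj] /=; first by rewrite scale0r addr0.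
rewrite He IHj linearD linearZ /= -addrA -scalerDl; congr (_ + _ *: _).
by rewrite doubleS -!natr1; ring.
Qed.

Lemma lower_iter_raise e f H j x : sl2_triple e f H ->
  f (iter j.+1 e x) =
    iter j.+1 e (f x) + j.+1%:R *: iter j e (H x + j%:R *: x).
Proof.
move=> T; have [fe He Hf] := T.
elim: j => [|j IHj]; first by rewrite /= fe scale0r addr0 scale1r.
rewrite iterS fe IHj (iter_weight _ _ T) linearD linearZ /= -!iterS -addrA.
rewrite !(iter_lfunD, iter_lfunZ); congr (_ + _).
move: (iter j.+1 e (H x)) (iter j.+1 e x) => a b.
rewrite !scalerDr !scalerA addrACA -{2}[a]scale1r -!scalerDl.
by rewrite -!muln2 !natrM -!natr1; congr (_ *: _ + _ *: _); ring.
Qed.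

(** The falling factorial H(H - 1)...(H - n + 1), with roots the weights 0, ..., n - 1. *)
Fixpoint ffactor H n : 'End(V) :=
  if n is m.+1 then ((H - m%:R *: \1) \o ffactor H m)%VF else \1%VF.

Lemma ffactorS H n x : ffactor H n.+1 x = H (ffactor H n x) - n%:R *: ffactor H
  n x.
Proof. by rewrite /= !lfun_simp. Qed.

Lemma ffactor_morph g H H' n x : (forall y, g (H y) = H' (g y)) ->
  g (ffactor H n x) = ffactor H' n (g x).
Proof.
move=> gH; elim: n => [|n IHn]; first by rewrite /= !id_lfunE.
by rewrite !ffactorS linearB linearZ /= gH IHn.
Qed.

Lemma ffactor_eigen H n a x : H x = a *: x ->
  ffactor H n x = (\prod_(l < n) (a - l%:R)) *: x.
Proof.
move=> Hx; elim: n => [|n IHn]; first by rewrite /= id_lfunE big_ord0 scale1r.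
rewrite ffactorS IHn linearZ /= Hx big_ord_recr /= !scalerA -scalerBl.
by congr (_ *: _); ring.
Qed.

(** Moving one e through f^(j + 1) leaves -(j + 1) f^j (H - j) v, and (H - j) v lies in ker e
    again. *)
Lemma iter_raise_lower e f H j v : sl2_triple e f H -> e v = 0 ->
  iter j e (iter j f v) = ((-1) ^+ j * j`!%:R) *: ffactor H j v.
Proof.
move=> T; have T' := sl2_triple_sym T; have [fe He Hf] := T.
elim: j v => [|j IHj] v ev0; first by rewrite /= id_lfunE expr0 mul1r scale1r.
rewrite iterSr (lower_iter_raise _ _ T') ev0 iter_lfun0 add0r iter_lfunZ.
have -> : (- H) v + j%:R *: v = (-1) *: (H v - j%:R *: v).
  by rewrite opp_lfunE scaleN1r opprB addrC.
rewrite !iter_lfunZ IHj; last first.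
  rewrite linearB linearZ /= ev0 scaler0 subr0.
  by apply/eqP; have := He v; rewrite ev0 linear0 scaler0 addr0 => <-.
rewrite ffactorS linearB [X in _ - X]linearZ /= (ffactor_morph (H' := H)) //
  !scalerA.
by congr (_ *: _); rewrite exprS factS natrM; ring.
Qed.

(** Since f^j = 0 for j = dim V, [iter_raise_lower] gives zero, and its scalar is invertible in
    characteristic zero. *)
Lemma ffactor_ker e f H v : sl2_triple e f H -> e v = 0 ->
  ffactor H (\dim {:V}) v = 0.
Proof.
move=> T ev0; apply/eqP; have := iter_raise_lower (\dim {:V}) T ev0.
rewrite (sl2_triple_nilp (sl2_triple_sym T)) iter_lfun0 => /esym/eqP.
rewrite scaler_eq0 mulf_eq0 signr_eq0 natf_eq0 /=.
by rewrite -leqn0 leqNgt fact_gt0.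
Qed.

(** If n is least with H(H - 1)...(H - n + 1) x = 0, the product one factor shorter gives a vector
    of weight n - 1. The subspace P serves both for im f and for submodules. *)
Lemma exists_weight_vector e f H (P : {vspace V}) x : sl2_triple e f H ->
    (forall y, y \in P -> H y \in P) -> x \in P -> x != 0 -> e x = 0 ->
  exists (m : nat) v, [/\ v \in P, v != 0, e v = 0 & H v = m%:R *: v].
Proof.
move=> T HP Px x_neq0 ex0; have [_ He _] := T.
have fP n : ffactor H n x \in P /\ e (ffactor H n x) = 0.
  elim: n => [|n [Pn en0]]; first by rewrite /= id_lfunE.
  rewrite ffactorS; split; first by rewrite rpredB ?rpredZ ?HP.
  rewrite linearB linearZ /= en0 scaler0 subr0.
  by have := He (ffactor H n x); rewrite en0 linear0 scaler0 addr0.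
have ex : exists n, ffactor H n x == 0.
  by exists (\dim {:V}); rewrite (ffactor_ker T ex0).
case: (ex_minnP ex) => -[|m] /eqP Hm0 minm.
  by move: x_neq0; rewrite -Hm0 /= id_lfunE eqxx.
exists m, (ffactor H m x); have [Pm em0] := fP m; split=> //.
  by apply/negP => /minm; rewrite ltnn.
by apply/eqP; rewrite -subr_eq0 -ffactorS Hm0.
Qed.

(** The annihilating falling factorial has distinct roots, so H is diagonalizable on ker e; each
    induction step splits off the component of the largest root. *)
Lemma ker_weight_ind e f H (D : {vspace V}) x : sl2_triple e f H ->
    (forall (m : nat) v, e v = 0 -> H v = m%:R *: v -> v \in D) ->
  e x = 0 -> x \in D.
Proof.
move=> T wD ex0; have [_ He _] := T.
have := ffactor_ker T ex0; elim: (\dim _) x ex0 => [|n IHn] x ex0.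
  by rewrite /= id_lfunE => ->; rewrite mem0v.
rewrite ffactorS => /eqP; rewrite subr_eq0 => /eqP Hn.
have en0 m : e (ffactor H m x) = 0.
  elim: m => [|m em0]; first by rewrite /= id_lfunE.
  rewrite ffactorS linearB linearZ /= em0 scaler0 subr0.
  by have := He (ffactor H m x); rewrite em0 linear0 scaler0 addr0.
(* The value n! of the falling factorial at n, the weight of [ffactor H n x]. *)
pose c : K := \prod_(l < n) (n%:R - l%:R).
have c_neq0 : c != 0.
  apply/prodf_neq0 => l _; rewrite -natrB ?natf_eq0 1?ltnW //.
  by rewrite subn_eq0 -ltnNge.
have Dy : ffactor H n x \in D by apply: wD Hn; apply: en0.
suff : x - c^-1 *: ffactor H n x \in D by rewrite rpredBr ?rpredZ.
apply: IHn; first by rewrite linearB linearZ /= ex0 en0 scaler0 subrr.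
rewrite linearB linearZ /= (ffactor_eigen n Hn) scalerA mulVf //.
by rewrite scale1r subrr.
Qed.

(** Otherwise some v = f u of weight m is nonzero in ker e, where u may be given weight m + 2. Then
    f e^(j + 1) u = (j + 1)(m + 2 + j) e^j u, so nilpotency of e forces u = 0. *)
Lemma ker_raise_lower_eq0 e f H u : sl2_triple e f H ->
  e (f u) = 0 -> f u = 0.
Proof.
move=> T efu0; apply/eqP/negPn/negP => fu_neq0.
have T' := sl2_triple_sym T; have [fe He Hf] := T.
have fH y : f (H y) = (H + 2%:R *: \1)%VF (f y).
  by rewrite !lfun_simp /= Hf subrK.
have [m [v [Pv v_neq0 ev0 Hv]]] : exists (m : nat) v,
    [/\ v \in limg f, v != 0, e v = 0 & H v = m%:R *: v].
  apply: (exists_weight_vector T) efu0 => //; last by rewrite memv_img ?memvf.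
  move=> _ /memv_imgP[z _ ->]; rewrite Hf -linearZ -linearB /=.
  by rewrite memv_img ?memvf.
have {u efu0 fu_neq0 Pv} [u _ vE] := memv_imgP Pv.
pose q : K := \prod_(l < \dim {:V}) (- (m + 2)%:R - l%:R).
have q_neq0 : q != 0.
  apply/prodf_neq0 => l _; rewrite -opprD oppr_eq0 -natrD natf_eq0.
  by rewrite addn2 addSn.
(* Only f (H u - (m + 2) u) = 0 is known of u. The falling factorial of -H kills ker f, so it turns
   u into a vector of weight m + 2, while f u is only scaled by q. *)
pose u1 := ffactor (- H) (\dim {:V}) u.
have fu1 : f u1 = q *: v.
  rewrite (ffactor_morph (H' := - (H + 2%:R *: \1)%VF)) => [|y].
    rewrite -vE; apply: ffactor_eigen.
    by rewrite !lfun_simp /= Hv -scalerDl -scaleNr natrD.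
  by rewrite !opp_lfunE linearN /= fH.
have Hu1 : H u1 = (m + 2)%:R *: u1.
  have H0 : f (H u - (m + 2)%:R *: u) = 0.
    rewrite linearB linearZ /= fH -vE !lfun_simp /= Hv -scalerDl -natrD.
    by rewrite subrr.
  have := ffactor_ker T' H0; rewrite linearB linearZ /= -/u1.
  rewrite -(ffactor_morph (g := H) (H := - H)) -/u1; last first.
    by move=> y; rewrite !opp_lfunE linearN.
  by move/eqP; rewrite subr_eq0 => /eqP.
have down j : iter j e u1 = 0.
  have [k lek] : exists k, (\dim {:V} <= j + k)%N.
    by exists (\dim {:V}); rewrite leq_addl.
  elim: k j lek => [|k IHk] j lek.
    by rewrite (iter_nilp_eq0 (sl2_triple_nilp T)) // -[j]addn0.
  have := lower_iter_raise j u1 T; rewrite IHk ?addSnnS // linear0 fu1.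
  rewrite iter_lfunZ iterSr ev0 iter_lfun0 scaler0 add0r Hu1 -scalerDl -natrD.
  rewrite iter_lfunZ scalerA -natrM => /esym/eqP; rewrite scaler_eq0 natf_eq0.
  by rewrite addn2 !addSn muln_eq0 /= => /eqP.
have u10 : u1 = 0 := down 0%N.
have /eqP := fu1; rewrite u10 linear0 eq_sym scaler_eq0.
by rewrite (negPf q_neq0) (negPf v_neq0).
Qed.

End Triple.

(** * The reflection h *)

Section Reflection.
Variables (K : fieldType) (V : vectType K).
Hypothesis char0 : [pchar K] =i pred0.
Variables e f H : 'End(V).
Hypothesis T : sl2_triple e f H.

Let natf_eq0 : forall n, (n%:R == 0 :> K) = (n == 0%N).
Proof. exact/pcharf0P. Qed.

Let T' : sl2_triple f e (- H) := sl2_triple_sym T.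
Let nil_e := sl2_triple_nilp char0 T.
Let nil_f := sl2_triple_nilp char0 T'.

Lemma exp_raise_conj (e' f' H' : 'End(V)) (x : V) : sl2_triple e' f' H' ->
  [/\ exp_nilp e' (e' x) = e' (exp_nilp e' x),
      exp_nilp e' (f' x) = f' (exp_nilp e' x) - H' (exp_nilp e' x) + e'
        (exp_nilp e' x) &
      exp_nilp e' (H' x) = H' (exp_nilp e' x) - 2%:R *: e' (exp_nilp e' x)].
Proof.
move=> S; have nil_e' := sl2_triple_nilp char0 S; have [fe He Hf] := S.
split.
- rewrite (exp_nilp_conj char0 nil_e' (C := 0) (D := 0)) => [|y|y|y];
    by rewrite !lfun_simp ?linear0 ?scaler0 ?addr0.
- rewrite (exp_nilp_conj char0 nil_e' (C := - H') (D := e')) => [|y|y|y] //.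
  + by rewrite !lfun_simp.
  + by rewrite fe opp_lfunE addrK.
  + by rewrite !opp_lfunE linearN /= He opprD subrK.
- rewrite (exp_nilp_conj char0 nil_e' (C := - (2%:R *: e')) (D := 0)) =>
  [|y|y|y].
  + by rewrite !lfun_simp addr0.
  + by rewrite He !lfun_simp addrK.
  + by rewrite !lfun_simp scaler0 addr0 linearN linearZ.
  + by rewrite !lfun_simp linear0.
Qed.

Definition reflection : 'End(V) :=
  (exp_nilp f \o exp_nilp e \o exp_nilp f)%VF.

Lemma reflectionE x :
  reflection x = exp_nilp f (exp_nilp e (exp_nilp f x)).
Proof. by rewrite !comp_lfunE. Qed.

(** exp(f) turns e into e + H + f, which exp(e) turns into e + (H - 2e) + (f - H + e) = f, and the
    last exp(f) commutes with f. *)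
Lemma reflection_raise x : reflection (e x) = f (reflection x).
Proof.
have [_ fe _] := exp_raise_conj x T'.
rewrite !reflectionE fe opp_lfunE opprK !linearD /=.
have [-> -> ->] := exp_raise_conj (exp_nilp f x) T.
set y := exp_nilp e _; have [<- _ _] := exp_raise_conj y T'.
rewrite -!linearD /=; congr (exp_nilp f _).
rewrite scaler_nat mulr2n opprD.
rewrite [LHS](AC (1*(1*(1*1))*((1*1)*1)) (5*(2*6)*(1*3)*(7*4))) /=.
by rewrite !subrr !addr0.
Qed.

Lemma reflection_lower x : reflection (f x) = e (reflection x).
Proof.
have [ff _ _] := exp_raise_conj x T'.
have [_ ef _] := exp_raise_conj (exp_nilp f x) T.
rewrite !reflectionE ff ef; set y := exp_nilp e _.
have [{}ff fe] := exp_raise_conj y T'; rewrite !opp_lfunE linearN /= => fH.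
rewrite linearD linearB /= ff fe fH; set z := exp_nilp f y.
rewrite opp_lfunE opprK scaler_nat mulr2n opprD.
rewrite [LHS](AC (1*(1*(1*1))*((1*1)*1)) (5*(2*6)*(1*3)*(7*4))) /=.
by rewrite addNr !subrr !addr0.
Qed.

Lemma reflection_weight x : reflection (H x) = - H (reflection x).
Proof.
have [fe _ _] := T.
have HE y : H y = f (e y) - e (f y) by rewrite fe addrAC subrr add0r.
by rewrite !HE linearB /= !(reflection_raise, reflection_lower) opprB.
Qed.

Lemma reflection_inj x : reflection x = 0 -> x = 0.
Proof.
by rewrite reflectionE => /(exp_nilp_inj nil_f)/(exp_nilp_inj
  nil_e)/(exp_nilp_inj nil_f).
Qed.

Lemma ker_raise_add_img_lower : (lker e + limg f)%VS = fullv.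
Proof.
have lker_h : lker reflection == 0%VS.
  rewrite -subv0; apply/subvP => x; rewrite memv_ker memv0 => /eqP.
  by move/reflection_inj ->.
have dim_f : \dim (limg f) = \dim (limg e).
  have -> : limg f = (reflection @: limg e)%VS.
    have he : (reflection \o e = f \o reflection)%VF.
      by apply/lfunP => x; rewrite 2!comp_lfunE reflection_raise.
    by rewrite -limg_comp he limg_comp (lker0_limgf lker_h).
  by rewrite limg_dim_eq // (eqP lker_h) capv0.
apply/eqP; rewrite eqEdim subvf dimv_disjoint_sum.
  by rewrite dim_f /=; have := limg_ker_dim e fullv; rewrite capfv => ->.
apply/eqP; rewrite -subv0; apply/subvP => x; rewrite memv_cap memv_ker memv0.
by case/andP => /eqP + /memv_imgP[u _ xE];
  rewrite xE => /(ker_raise_lower_eq0 char0 T) ->.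
Qed.

(** With x = y + f z and y in ker e, f^j x = f^j y + f^(j + 1) z; induction descends from a power
    with f^j = 0 to j = 0. *)
Lemma triple_ind (D : {vspace V}) :
    (forall (m : nat) v j, e v = 0 -> H v = m%:R *: v -> iter j f v \in D) ->
  D = fullv.
Proof.
move=> wD; apply/vspaceP => x; rewrite memvf.
suff jD j : iter j f x \in D by exact: (jD 0%N).
have [k lek] : exists k, (\dim {:V} <= j + k)%N.
  by exists (\dim {:V}); rewrite leq_addl.
elim: k j x lek => [|k IHk] j x lek.
  by rewrite (iter_nilp_eq0 nil_f) ?mem0v // -[j]addn0.
have : x \in (lker e + limg f)%VS by rewrite ker_raise_add_img_lower memvf.
case/memv_addP => y; rewrite memv_ker => /eqP ey0 [_ /memv_imgP[z _ ->] ->].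
rewrite iter_lfunD rpredD //; last by rewrite -iterSr IHk // addSnnS.
(* The preimage of D under f^j is a subspace, to which [ker_weight_ind] applies. *)
pose fj : 'End(V) := iter j (comp_lfun f) \1%VF.
rewrite -(iter_comp_lfunE f) -/fj memv_preim.
apply: (ker_weight_ind char0 T) ey0 => m v ev0 Hv.
by rewrite -memv_preim /fj iter_comp_lfunE (wD m).
Qed.

End Reflection.

(** * Highest weight vectors and the square of h *)

Section HighestWeight.
Variables (K : fieldType) (V : vectType K).
Hypothesis char0 : [pchar K] =i pred0.
Implicit Types (e f H : 'End(V)) (m : nat) (v : V).

Let natf_eq0 : forall n, (n%:R == 0 :> K) = (n == 0%N).
Proof. exact/pcharf0P. Qed.

Lemma exp_nilp_ker (A : 'End(V)) x : A x = 0 -> exp_nilp A x = x.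
Proof.
(* In dimension 0 the truncated series lacks even its constant term, but then x = 0. *)
move=> Ax0; rewrite exp_nilpE; have [dim0|] := posnP (\dim {:V}).
  have : x \in fullv by rewrite memvf.
  have /eqP := dim0; rewrite dimv_eq0 => /eqP ->; rewrite memv0 => /eqP ->.
  by rewrite big1 // => j _; rewrite iter_lfun0 scaler0.
move=> d_gt0; rewrite -(prednK d_gt0) big_ord_recl big1 /= => [|j _].
  by rewrite addr0 invr1 scale1r.
by rewrite -iterS iterSr Ax0 iter_lfun0 scaler0.
Qed.

Lemma iter_lower_weight e f H j m v : sl2_triple e f H -> H v = m%:R *: v ->
  H (iter j f v) = (m%:R - (j.*2)%:R) *: iter j f v.
Proof.
move=> T Hv; have := iter_weight j v (sl2_triple_sym T).
rewrite !opp_lfunE Hv -scaleNr iter_lfunZ -scalerDl => /(congr1 -%R).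
by rewrite opprK -scaleNr opprD opprK.
Qed.

(** The vector f^(m + 1) v is killed by e and has weight -m - 2, yet weights on ker e are natural
    numbers. *)
Lemma iter_lower_hw_eq0 e f H m v : sl2_triple e f H -> e v = 0 ->
  H v = m%:R *: v -> iter m.+1 f v = 0.
Proof.
move=> T ev0 Hv; set w := iter _ _ _.
have ew0 : e w = 0.
  have := lower_iter_raise m v (sl2_triple_sym T).
  by rewrite ev0 iter_lfun0 add0r opp_lfunE Hv addNr iter_lfun0 scaler0.
have := ffactor_ker char0 T ew0.
rewrite (ffactor_eigen _ (iter_lower_weight m.+1 T Hv)) => /eqP.
rewrite scaler_eq0 => /orP[|/eqP //]; rewrite prodf_seq_eq0 => /hasP[l _ /=].
rewrite doubleS -addnn -!natr1 natrD.
rewrite (_ : _ - _ = - (m + l).+2%:R) ?oppr_eq0 ?natf_eq0 //.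
by rewrite -!natr1 natrD; ring.
Qed.

Lemma iter_raise_lower_hw e f H m v : sl2_triple e f H -> e v = 0 ->
  H v = m%:R *: v -> iter m e (iter m f v) = ((-1) ^+ m * m`!%:R ^+ 2) *: v.
Proof.
move=> T ev0 Hv; rewrite (iter_raise_lower _ T ev0) (ffactor_eigen _ Hv).
rewrite scalerA expr2 mulrA; congr (_ * _ *: _).
rewrite -ffactnn ffact_prod natr_prod; apply: eq_bigr => l _.
by rewrite natrB // ltnW.
Qed.

(** e^m commutes with exp(e), and on exp(f) v it leaves only the term f^m v / m!: it kills the lower
    terms, and the higher ones are zero. *)
Lemma iter_raise_exp_hw e f H m v : sl2_triple e f H -> e v = 0 ->
    H v = m%:R *: v ->
  iter m e (exp_nilp e (exp_nilp f v)) = ((-1) ^+ m * m`!%:R) *: v.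
Proof.
move=> T ev0 Hv; have [->|v_neq0] := eqVneq v 0.
  by rewrite (exp_nilp_ker (linear0 _)) (exp_nilp_ker (linear0 _)) iter_lfun0
    scaler0.
have fm_neq0 : m`!%:R != 0 :> K by rewrite natf_eq0 -lt0n fact_gt0.
have eem j x : iter j e (exp_nilp e x) = exp_nilp e (iter j e x).
  elim: j => //= j ->.
  by have [-> _ _] := exp_raise_conj char0 (iter j e x) T.
(* The truncated series does contain the term of index m, because e^m f^m v is nonzero. *)
have lt_md : (m < \dim {:V})%N.
  rewrite ltnNge; apply/negP => led; have := iter_raise_lower_hw T ev0 Hv.
  rewrite (iter_nilp_eq0 (sl2_triple_nilp char0 (sl2_triple_sym T))) //
    iter_lfun0.
  move/esym/eqP; rewrite scaler_eq0 (negPf v_neq0) orbF mulf_eq0 signr_eq0.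
  by rewrite expf_eq0 (negPf fm_neq0).
rewrite eem [exp_nilp f v]exp_nilpE (big_morph _ (iter_lfunD e m) (iter_lfun0 e
  m)).
rewrite (bigD1 (Ordinal lt_md)) //= big1 => [|j nej]; last first.
  rewrite iter_lfunZ; have := nej; rewrite -val_eqE /= neq_ltn => /orP[ltj|gtj].
    rewrite -(subnK ltj) addnS -addSn iterD (iter_raise_lower _ T ev0).
    by rewrite (ffactor_eigen _ Hv) !iter_lfunZ iterSr ev0 iter_lfun0 !scaler0.
  by rewrite -(subnK gtj) iterD (iter_lower_hw_eq0 T ev0 Hv) !iter_lfun0
    scaler0.
rewrite addr0 iter_lfunZ (iter_raise_lower_hw T ev0 Hv) !linearZ /=.
rewrite (exp_nilp_ker ev0) scalerA; congr (_ *: _).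
by rewrite expr2 mulrCA mulKf.
Qed.

(** With w = f^m v, [iter_raise_exp_hw] for the triple and its mirror image gives h w = (-1)^m m! v
    and m! h v = w. *)
Lemma reflection_sq_hw e f H m v : sl2_triple e f H -> e v = 0 ->
    H v = m%:R *: v ->
  reflection e f (reflection e f v) = (-1) ^+ m *: v.
Proof.
move=> T ev0 Hv; set h := reflection e f; have T' := sl2_triple_sym T.
pose w := iter m f v.
have fm_neq0 : m`!%:R != 0 :> K by rewrite natf_eq0 -lt0n fact_gt0.
have he j x : h (iter j e x) = iter j f (h x).
  by elim: j => //= j <-; rewrite (reflection_raise char0 T).
have hf j x : h (iter j f x) = iter j e (h x).
  by elim: j => //= j <-; rewrite (reflection_lower char0 T).
have fw0 : f w = 0 := iter_lower_hw_eq0 T ev0 Hv.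
have Hw : (- H) w = m%:R *: w.
  rewrite opp_lfunE (iter_lower_weight _ T Hv) -scaleNr -addnn natrD.
  by congr (_ *: _); ring.
(* f h v = h e v = 0, so the outer exp(f) fixes h v and, being injective, can be cancelled. *)
have hvE : h v = exp_nilp e (exp_nilp f v).
  have fhv : f (h v) = 0 by rewrite -(reflection_raise char0 T) ev0 linear0.
  apply/eqP; rewrite -subr_eq0; apply/eqP.
  apply: (exp_nilp_inj (sl2_triple_nilp char0 T')).
  by rewrite linearB /= (exp_nilp_ker fhv) -reflectionE subrr.
have hw : h w = ((-1) ^+ m * m`!%:R) *: v.
  by rewrite hf hvE (iter_raise_exp_hw T ev0 Hv).
have hv : m`!%:R *: h v = w.
  have : h (iter m e w) = ((-1) ^+ m * m`!%:R) *: w.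
    by rewrite he /h reflectionE (exp_nilp_ker fw0) (iter_raise_exp_hw T' fw0
      Hw).
  rewrite (iter_raise_lower_hw T ev0 Hv) linearZ /= expr2 -!scalerA.
  have s_neq0 : (-1) ^+ m != 0 :> K by rewrite signr_eq0.
  by move/(scalerI s_neq0)/(scalerI fm_neq0).
apply: (scalerI fm_neq0); rewrite -linearZ /= hv hw scalerA.
by rewrite mulrC.
Qed.

End HighestWeight.

(** * Irreducible submodules *)

Section Irreducible.
Variables (K : fieldType) (V : vectType K).
Hypothesis char0 : [pchar K] =i pred0.
Variables e f H : 'End(V).
Hypothesis T : sl2_triple e f H.
Implicit Types (U W : {vspace V}) (m : nat) (v x : V).

Let natf_eq0 : forall n, (n%:R == 0 :> K) = (n == 0%N).
Proof. exact/pcharf0P. Qed.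

Let T' : sl2_triple f e (- H) := sl2_triple_sym T.

Definition triple_stable U : Prop :=
  forall x, x \in U -> [/\ e x \in U, f x \in U & H x \in U].

Definition string m v : m.+1.-tuple V := [tuple iter j f v | j < m.+1].

Definition hw_vector m v : Prop := [/\ v != 0, e v = 0 & H v = m%:R *: v].

Lemma mem_string m v j : (j <= m)%N -> iter j f v \in <<string m v>>%VS.
Proof. by move=> lejm; apply/memv_span/tnthP; exists (@Ordinal m.+1 j lejm);
  rewrite tnth_mktuple. Qed.

Lemma triple_stable_string m v : hw_vector m v -> triple_stable <<string m
  v>>%VS.
Proof.
case=> _ ev0 Hv x Ux.
have sub (g : 'End(V)) : (forall j, (j <= m)%N -> g (iter j f v) \in <<string m
  v>>%VS) ->
    g x \in <<string m v>>%VS.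
  move=> gU; rewrite memv_preim; apply: subvP Ux;
    apply/span_subvP => y /tnthP[j ->]; rewrite tnth_mktuple.
  by rewrite -memv_preim; apply: gU; rewrite -ltnS.
split; apply: sub => j lejm.
- case: j lejm => [|j] lejm; first by rewrite /= ev0 mem0v.
  rewrite (lower_iter_raise _ _ T') ev0 iter_lfun0 add0r opp_lfunE Hv -scaleNr
    -scalerDl.
  by rewrite iter_lfunZ !rpredZ // mem_string // ltnW.
- rewrite -iterS; have [->|nej] := eqVneq j m.
    by rewrite (iter_lower_hw_eq0 char0 T ev0 Hv) mem0v.
  by rewrite mem_string // ltn_neqAle nej.
- by rewrite (iter_lower_weight _ T Hv) rpredZ // mem_string.
Qed.

(** For the least j with a_j nonzero, f^(m - j) pushes all later terms past f^m v, hence to 0. *)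
Lemma iter_lower_string m v (a : 'I_m.+1 -> K) : hw_vector m v ->
    (exists j, a j != 0) ->
  exists k c, c != 0 /\
    iter k f (\sum_(j < m.+1) a j *: (string m v)`_j) = c *: iter m f v.
Proof.
move=> [_ ev0 Hv] [j0 aj0].
case: (@arg_minnP _ j0 (fun j => a j != 0) val aj0) => j aj minj.
exists (m - j)%N, (a j); split=> //.
rewrite (eq_bigr (fun l : 'I_m.+1 => a l *: iter l f v)) => [|l _]; last first.
  by rewrite -tnth_nth tnth_mktuple.
rewrite (big_morph _ (iter_lfunD f _) (iter_lfun0 f _)) (bigD1 j) //=.
rewrite big1 ?addr0 => [|l nel].
  by rewrite iter_lfunZ -iterD subnK // -ltnS.
rewrite iter_lfunZ -iterD.
have [ltlj|] := ltnP l j.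
  have [->|/minj] := eqVneq (a l) 0; first by rewrite scale0r.
  by rewrite leqNgt ltlj.
rewrite leq_eqVlt eq_sym val_eqE (negPf nel) /= => ltjl.
have /subnK <- : (m.+1 <= m - j + l)%N.
  have lejm : (j <= m)%N by rewrite -ltnS.
  by rewrite -{1}(subnK lejm) -addnS leq_add2l.
by rewrite iterD (iter_lower_hw_eq0 char0 T ev0 Hv) iter_lfun0 scaler0.
Qed.

Lemma iter_raise_lower_hw_neq0 m v : hw_vector m v ->
  exists2 c, c != 0 & iter m e (iter m f v) = c *: v.
Proof.
case=> _ ev0 Hv; exists ((-1) ^+ m * m`!%:R ^+ 2);
  last exact: iter_raise_lower_hw T ev0 Hv.
by rewrite mulf_eq0 signr_eq0 expf_eq0 natf_eq0 /= -leqn0 leqNgt fact_gt0.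
Qed.

Lemma free_string m v : hw_vector m v -> free (string m v).
Proof.
move=> hv; apply/freeP => a a0 j; apply/eqP/negPn/negP => aj.
have [k [c [c0]]] := iter_lower_string hv (ex_intro _ j aj).
have [d d0 Ed] := iter_raise_lower_hw_neq0 hv.
rewrite a0 iter_lfun0 => /(congr1 (iter m e));
  rewrite iter_lfun0 iter_lfunZ Ed scalerA.
move/esym/eqP; rewrite scaler_eq0 mulf_eq0 (negPf c0) (negPf d0) /=.
by case: hv => /negPf ->.
Qed.

Lemma dim_string m v : hw_vector m v -> \dim <<string m v>> = m.+1.
Proof. by move/free_string/eqP ->; rewrite size_tuple. Qed.

(** A power of f followed by e^m takes x to a nonzero multiple of v, which generates the string.
    This makes strings irreducible. *)
Lemma string_sub_stable m v W x : hw_vector m v -> triple_stable W ->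
  x \in W -> x \in <<string m v>>%VS -> x != 0 -> (<<string m v>> <= W)%VS.
Proof.
move=> hv Wst Wx Ux x0.
have We y j : y \in W -> iter j e y \in W.
  by move=> Wy; elim: j => //= j /Wst[].
have Wf y j : y \in W -> iter j f y \in W.
  by move=> Wy; elim: j => //= j /Wst[].
have xE := coord_span Ux.
have aj : exists j, coord (string m v) j x != 0.
  apply/existsP; rewrite -negb_forall; apply: contra x0 => /forallP a0.
  by rewrite xE big1 // => j _; rewrite (eqP (a0 j)) scale0r.
have [k [c [c0]]] := iter_lower_string hv aj; rewrite -xE => kx.
have [d d0 Ed] := iter_raise_lower_hw_neq0 hv.
have Wv : v \in W.
  have := We _ m (Wf _ k Wx); rewrite kx iter_lfunZ Ed scalerA rpredZeq.
  by rewrite mulf_eq0 (negPf c0) (negPf d0).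
by apply/span_subvP => y /tnthP[j ->]; rewrite tnth_mktuple; apply: Wf.
Qed.

(** Raising a nonzero vector of U as far as possible ends in ker e, where [exists_weight_vector]
    supplies v. *)
Lemma exists_string U : triple_stable U -> U != 0%VS ->
  exists m v, hw_vector m v /\ (<<string m v>> <= U)%VS.
Proof.
move=> Ust U0; have Ux := memv_pick U; have x0 : vpick U != 0 by rewrite vpick0.
have Ue j : iter j e (vpick U) \in U by elim: j => //= j /Ust[].
have ex : exists n, iter n e (vpick U) == 0.
  by exists (\dim {:V}); rewrite (sl2_triple_nilp char0 T).
case: (ex_minnP ex) => -[|n] /eqP en0 minn.
  by have := x0; rewrite -en0 eqxx.
have y0 : iter n e (vpick U) != 0 by apply/negP => /minn; rewrite ltnn.
have HU y : y \in U -> H y \in U by case/Ust.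
have [m [v [Uv v0 ev0 Hv]]] := exists_weight_vector char0 T HU (Ue n) y0 en0.
have hv : hw_vector m v by [].
exists m, v; split=> //; apply: string_sub_stable hv Ust Uv _ v0.
exact: (@mem_string m v 0).
Qed.

Let h := reflection e f.

Lemma reflection_sq_comm (g : 'End(V)) : g \in [:: e; f; H] ->
  forall x, h (h (g x)) = g (h (h x)).
Proof.
rewrite !inE => /or3P[] /eqP -> x.
- by rewrite /h (reflection_raise char0 T) (reflection_lower char0 T).
- by rewrite /h (reflection_lower char0 T) (reflection_raise char0 T).
- by rewrite /h !(reflection_weight char0 T) linearN /= (reflection_weight
  char0 T) opprK.
Qed.

Lemma reflection_sq_string m v x : hw_vector m v -> x \in <<string m v>>%VS ->
  h (h x) = (-1) ^+ m *: x.
Proof.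
move=> [_ ev0 Hv] Ux.
have /eqlfunP : x \in lker (h \o h - (-1) ^+ m *: \1%VF)%VF.
  apply: subvP Ux; apply/span_subvP => y /tnthP[j ->]; rewrite tnth_mktuple;
    apply/eqlfunP.
  rewrite comp_lfunE scale_lfunE id_lfunE; elim: (val j) => [|n IHn] /=.
    exact: (reflection_sq_hw char0 T ev0 Hv).
  by rewrite reflection_sq_comm ?inE ?eqxx ?orbT // IHn linearZ.
by rewrite comp_lfunE scale_lfunE id_lfunE.
Qed.

(** The strings span V by [triple_ind]. *)
Lemma lfun_eq_on_strings (g1 g2 : 'End(V)) :
    (forall m v x, hw_vector m v -> x \in <<string m v>>%VS -> g1 x = g2 x) ->
  g1 = g2.
Proof.
move=> gE; apply/lfunP => x; apply/eqlfunP.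
suff -> : lker (g1 - g2) = fullv by rewrite memvf.
apply: (triple_ind char0 T) => m v j ev0 Hv.
have [->|v0] := eqVneq v 0; first by rewrite iter_lfun0 mem0v.
apply/eqlfunP; have [lejm|ltmj] := leqP j m.
  by apply: (gE m v); rewrite ?mem_string.
by rewrite -(subnK ltmj) iterD (iter_lower_hw_eq0 char0 T ev0 Hv) iter_lfun0
  !linear0.
Qed.

Lemma reflection_order4 x : h (h (h (h x))) = x.
Proof.
suff /lfunP/(_ x) : (h \o h \o h \o h = \1)%VF by rewrite 3!comp_lfunE id_lfunE.
apply: lfun_eq_on_strings => m v y hv Uy; rewrite 3!comp_lfunE id_lfunE.
have st := triple_stable_string hv.
rewrite (reflection_sq_string hv) ?(reflection_sq_string hv Uy) ?rpredZ //.
by rewrite scalerA -expr2 sqrr_sign scale1r.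
Qed.

End Irreducible.

(** * The twisted module *)

(** Expressions are evaluated with composition as product, for every V including V = 0, where [\1]
    and 0 coincide. *)
Lemma algA_module_exists (K : fieldType) (V : vectType K) (x y z : 'End(V)) :
    (x \o y)%VF + (y \o x)%VF = 2%:R *: z -> (y \o z)%VF + (z \o y)%VF = 2%:R
      *: x ->
    (z \o x)%VF + (x \o z)%VF = 2%:R *: y ->
  exists act : algA K -> 'End(V), algebra_module act /\
    [/\ act (Ax K) = x, act (Ay K) = y & act (Az K) = z].
Proof.
move=> xy yz zx.
pose ev := fix ev (a : expr K) : 'End(V) := match a with
  | Cst c => c *: \1%VF | Gx => x | Gy => y | Gz => z
  | Add a b => ev a + ev b | Mul a b => (ev a \o ev b)%VF end.
have evP a b : cong a b -> ev a = ev b.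
  elim=> {a b} /=; do ?[by move=> *; congruence]; move=> *;
    rewrite -?comp_lfunZl -?comp_lfunZr ?(comp_lfun1l, comp_lfun1r)
      ?(scaleN1r, scale1r, scale0r, add0r, addNr) //.
  - by rewrite addrA.
  - by rewrite addrC.
  - by rewrite comp_lfunA.
  - by rewrite comp_lfunDl.
  - by rewrite comp_lfunDr.
  - by rewrite scalerDl.
  - by rewrite scalerA.
pose act (p : algA K) := ev (repr p).
have actE a : act (to_algA a) = ev a by apply/evP/repr_to_algA.
exists act; split; last by split; apply: actE.
split; first move=> c.
- elim/algAW=> a; elim/algAW=> b.
  by rewrite -to_algAZ -to_algAD !actE /= -comp_lfunZl comp_lfun1l.
- by rewrite [LHS]actE /= scale1r.
- by elim/algAW=> a; elim/algAW=> b; rewrite -to_algAM !actE.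
Qed.

(** * The operators k and s on an sl_2-module *)

Section Sl2Module.
Variables (K : fieldType) (V : vectType K) (i : K) (rho : sl2 K -> 'End(V)).
Hypotheses (char0 : [pchar K] =i pred0) (i2 : i ^+ 2 = -1)
  (rhoP : sl2_module i rho).
Implicit Types (U : {vspace V}) (x : V).

Let X := rho (sl2X K).
Let Y := rho (sl2Y K).
Let Z := rho (sl2Z K).
Let e := Nplus i rho.
Let f := Nminus i rho.

Let lfunD (g : 'End(V)) : {morph g : x y / x + y}. Proof. exact: linearD. Qed.
Let lfunZ (g : 'End(V)) a : {morph g : x / a *: x}. Proof. exact: linearZ. Qed.

Let two_neq0 : 2%:R != 0 :> K.
Proof. by have /pcharf0P -> := char0. Qed.

Let ii : i * i = -1. Proof. by rewrite -expr2. Qed.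

Lemma sl2_moduleZ a u : rho (a *: u) = a *: rho u.
Proof.
have [lin _] := rhoP; have rho0 : rho 0 = 0.
  by have := lin (-1) 0 0; rewrite !scaleN1r !addNr.
by have := lin a u 0; rewrite !addr0 rho0 addr0.
Qed.

Lemma sl2_module_comm x :
  [/\ X (Y x) = Y (X x) + (2%:R * i) *: Z x,
      Y (Z x) = Z (Y x) + (2%:R * i) *: X x &
      Z (X x) = X (Z x) + (2%:R * i) *: Y x].
Proof.
have [_ br] := rhoP.
have brE u v w : sl2_bracket i u v = (2%:R * i) *: w ->
    rho u (rho v x) = rho v (rho u x) + (2%:R * i) *: rho w x.
  move=> uv; have := br u v; rewrite uv sl2_moduleZ => /lfunP/(_ x).
  by rewrite !lfun_simp /= => ->; rewrite addrC subrK.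
split; apply: brE.
- exact: sl2_bracketXY.
- exact: sl2_bracketYZ.
- exact: sl2_bracketZX.
Qed.

Lemma NplusE x : e x = 2%:R^-1 *: (i *: Y x + X x).
Proof. by rewrite /e /Nplus !lfun_simp. Qed.

Lemma NminusE x : f x = 2%:R^-1 *: (i *: Y x - X x).
Proof. by rewrite /f /Nminus !lfun_simp. Qed.

Let coordD : {morph @VectorInternalTheory.v2r K V : u v / u + v}.
Proof. by move=> u v; rewrite linearD. Qed.
Let coordN : {morph @VectorInternalTheory.v2r K V : u / - u}.
Proof. by move=> u; rewrite linearN. Qed.
Let coordZ a : {morph @VectorInternalTheory.v2r K V : u / a *: u}.
Proof. by move=> u; rewrite linearZ. Qed.

(* Vector identities with scalar coefficients are checked in coordinates. *)
Local Ltac by_coordinates :=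
  apply: VectorInternalTheory.v2r_inj;
  rewrite !(coordD, coordN, coordZ);
  apply/rowP => ?; rewrite !mxE;
  first [by ring: ii | by field: ii; exact: two_neq0].

Lemma XE x : X x = e x - f x.
Proof. by rewrite NplusE NminusE; move: (X x) (Y x) => a b; by_coordinates. Qed.

Lemma YE x : Y x = - i *: (e x + f x).
Proof. by rewrite NplusE NminusE; move: (X x) (Y x) => a b; by_coordinates. Qed.

Lemma sl2_triple_N : sl2_triple e f Z.
Proof.
split=> x; have [XY YZ ZX] := sl2_module_comm x;
  rewrite !(NplusE, NminusE) !(linearD, linearN, linearZ) /= ?XY ?ZX.
- by move: (Y (Y x)) (Y (X x)) (X (X x)) (Z x) => a b c d; by_coordinates.
- have -> : Z (Y x) = Y (Z x) - (2%:R * i) *: X x by rewrite YZ addrK.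
  by move: (X x) (Y x) (Y (Z x)) (X (Z x)) => a b c d; by_coordinates.
- have -> : Z (Y x) = Y (Z x) - (2%:R * i) *: X x by rewrite YZ addrK.
  by move: (X x) (Y x) (Y (Z x)) (X (Z x)) => a b c d; by_coordinates.
Qed.

Let T := sl2_triple_N.
Let h := h_op i rho.

Lemma sl2_decomp u :
  rho u = u 0 0 *: X + u 0 1 *: Y + u 0 2%:R *: Z.
Proof.
have [lin _] := rhoP; have uE : u = u 0 0 *: sl2X K + (u 0 1 *: sl2Y K + u 0
  2%:R *: sl2Z K).
  apply/rowP; case; case=> [|[|[|//]]] lt3;
    rewrite !mxE /= ?(mulr0, mulr1, addr0, add0r);
    by congr (u _ _); apply: val_inj.
by rewrite {1}uE !lin sl2_moduleZ addrA.
Qed.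

Lemma submoduleP U : submodule rho U <-> triple_stable e f Z U.
Proof.
split=> [sub x Ux|st u].
  have rU w : rho w x \in U by apply: subvP (sub w) _ (memv_img _ Ux).
  by rewrite NplusE NminusE; split; rewrite ?(rpredZ, rpredB, rpredD) ?rU.
apply/subvP => _ /memv_imgP[x Ux ->]; have [Ue Uf UZ] := st x Ux.
by rewrite sl2_decomp !lfun_simp XE YE !rpredD ?rpredZ ?rpredB ?rpredD.
Qed.

Lemma irreducible_string m v : hw_vector e Z m v ->
  irreducible_submodule rho <<string f m v>>%VS.
Proof.
move=> hv; have st := triple_stable_string char0 T hv; have [v0 _ _] := hv.
split; first exact/submoduleP.
  by rewrite -dimv_eq0 (dim_string char0 T hv).
move=> W /submoduleP Wst WU; have [->|W0] := eqVneq W 0%VS; first by left.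
right; apply/eqP; rewrite eqEsubv WU /=.
apply: (string_sub_stable char0 T hv Wst (memv_pick W)); last by rewrite vpick0.
exact: subvP WU _ (memv_pick W).
Qed.

(** U contains a string, itself a nonzero submodule, and minimality of U makes them equal. *)
Lemma irreducible_is_string U : irreducible_submodule rho U ->
  exists m v, hw_vector e Z m v /\ U = <<string f m v>>%VS.
Proof.
case=> /submoduleP Ust U0 Umin.
have [m [v [hv sub]]] := exists_string char0 T Ust U0.
exists m, v; split=> //.
have [sub_s s0 _] := irreducible_string hv.
by case: (Umin _ sub_s sub) => // sE; rewrite sE eqxx in s0.
Qed.

(* h^2 acts as (-1)^m on the irreducible of dimension m + 1, so that k is the
   polynomial (1 + h^2)/2 - i (1 - h^2)/2 in h^2. *)
Definition k_poly : 'End(V) :=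
  2%:R^-1 *: ((1 - i) *: \1 + (1 + i) *: (h \o h))%VF.

Lemma k_polyE x : k_poly x = 2%:R^-1 *: ((1 - i) *: x + (1 + i) *: h (h x)).
Proof. by rewrite scale_lfunE add_lfunE 2!scale_lfunE id_lfunE comp_lfunE. Qed.

(** The dimension is m + 1, so odd dimension means h^2 = 1, where the polynomial is 1; for h^2 = -1
    it is -i. *)
Lemma k_spec_k_poly : k_spec i rho k_poly.
Proof.
move=> U /irreducible_is_string[m [v [hv ->]]] x Ux.
rewrite k_polyE (reflection_sq_string char0 T hv Ux) (dim_string char0 T hv) /=.
rewrite -signr_odd; case: (odd m); by_coordinates.
Qed.

(** [k_poly] witnesses that [xget] returns a solution of [k_spec], and two solutions agree on all
    strings. *)
Lemma k_opE : k_op i rho = k_poly.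
Proof.
have kP : k_spec i rho (k_op i rho) by apply: xgetPex; exists k_poly;
  apply: k_spec_k_poly.
apply: (lfun_eq_on_strings char0 T) => m v x hv Ux.
have irr := irreducible_string hv.
by rewrite (kP _ irr x Ux) (k_spec_k_poly irr Ux).
Qed.

Let s := s_op i rho.

Lemma s_opE x : s x = h (k_poly x).
Proof. by rewrite /s /s_op k_opE comp_lfunE. Qed.

Lemma k_poly_comm (g : 'End(V)) x : g \in [:: e; f;
  Z] -> k_poly (g x) = g (k_poly x).
Proof.
move=> gin; rewrite !k_polyE (reflection_sq_comm char0 T gin).
by rewrite !(lfunZ g, lfunD g).
Qed.

(** As k commutes with e, f and Z, s swaps e and f just as h does; X is e - f and Y is -i (e +
    f). *)
Lemma s_op_anticomm x :
  [/\ s (X x) = - X (s x), s (Y x) = Y (s x) & s (Z x) = - Z (s x)].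
Proof.
have se y : s (e y) = f (s y).
  by rewrite !s_opE k_poly_comm ?inE ?eqxx // (reflection_raise char0 T).
have sf y : s (f y) = e (s y).
  by rewrite !s_opE k_poly_comm ?inE ?eqxx ?orbT // (reflection_lower char0 T).
split.
- by rewrite !XE linearB /= se sf opprB.
- by rewrite !YE linearZ linearD /= se sf addrC.
- by rewrite !s_opE k_poly_comm ?inE ?eqxx ?orbT // (reflection_weight char0 T).
Qed.

(** Since (1 - i)^2 + (1 + i)^2 = 0 and h^4 = 1, k^2 = h^2, whence s^2 = h^4. *)
Lemma s_op_sq x : s (s x) = x.
Proof.
have hk y : h (k_poly y) = k_poly (h y).
  by rewrite !k_polyE !(lfunZ h, lfunD h).
have h4 := reflection_order4 char0 T : forall y, h (h (h (h y))) = y.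
rewrite !s_opE hk !k_polyE !(lfunZ h, lfunD h) !h4.
by move: (h (h x)) => y; by_coordinates.
Qed.

(** The choices c = 1 and c = -1 give the two structures. Moving s to the left gives xy + yx = -c s
    [X, Y] and zx + xz = -c i s [Z, X], while s^2 = 1 gives yz + zy = -i [Y, Z]. *)
Lemma twisted_relations (c : K) : c ^+ 2 = 1 ->
  let y := c *: (s \o Y)%VF in let z := - (c * i) *: (s \o Z)%VF in
  [/\ (X \o y)%VF + (y \o X)%VF = 2%:R *: z,
      (y \o z)%VF + (z \o y)%VF = 2%:R *: X &
      (z \o X)%VF + (X \o z)%VF = 2%:R *: y].
Proof.
move=> c2 y z.
have yE x : y x = c *: s (Y x) by rewrite scale_lfunE comp_lfunE.
have zE x : z x = - (c * i) *: s (Z x) by rewrite scale_lfunE comp_lfunE.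
clearbody y z.
split; apply/lfunP => x; rewrite add_lfunE 2!comp_lfunE scale_lfunE;
  have [XY YZ ZX] := sl2_module_comm x.
- rewrite !yE zE lfunZ; have [sX _ _] := s_op_anticomm (Y x).
  rewrite -[X (s _)]opprK -sX XY lfunD lfunZ.
  by move: (s (Y (X x))) (s (Z x)) => a b; by_coordinates.
- rewrite !yE !zE !lfunZ.
  have [_ <- _] := s_op_anticomm (Z x); have [_ _ sZ] := s_op_anticomm (Y x).
  rewrite -[Z (s _)]opprK -sZ (linearN s) /= !s_op_sq YZ.
  (* With c^2 in place of 1 the identity is polynomial in c and uses only i^2 = -1. *)
  rewrite -[2%:R in RHS]mul1r -c2.
  by move: (Z (Y x)) (X x) => a b; by_coordinates.
- rewrite !zE yE !lfunZ; have [sX _ _] := s_op_anticomm (Z x).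
  rewrite -[X (s _)]opprK -sX ZX lfunD lfunZ.
  by move: (s (X (Z x))) (s (Y x)) => a b; by_coordinates.
Qed.

Lemma twisted_algA_module (c : K) : c ^+ 2 = 1 ->
  exists act : algA K -> 'End(V), algebra_module act /\
    [/\ act (Ax K) = X, act (Ay K) = c *: (s \o Y)%VF &
        act (Az K) = - (c * i) *: (s \o Z)%VF].
Proof. by move=> c2; have [xy yz zx] := twisted_relations c2;
  apply: algA_module_exists. Qed.

End Sl2Module.

Theorem theorem5p15 (K : closedFieldType) (char0 : [pchar K] =i pred0)
    (i : K) (i2 : i ^+ 2 = -1) (V : vectType K)
    (rho : sl2 K -> 'End(V)) (rhoP : sl2_module i rho) :
  let X := rho (sl2X K) in
  let Y := rho (sl2Y K) in
  let Z := rho (sl2Z K) in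
  let s := s_op i rho in
  (exists act : algA K -> 'End(V),
     algebra_module act /\
     [/\ act (Ax K) = X, act (Ay K) = (s \o Y)%VF &
         act (Az K) = - i *: (s \o Z)%VF]) /\
  (exists act : algA K -> 'End(V),
     algebra_module act /\
     [/\ act (Ax K) = X, act (Ay K) = - (s \o Y)%VF &
         act (Az K) = i *: (s \o Z)%VF]).
Proof.
split.
  have [act [actP []]] := twisted_algA_module char0 i2 rhoP (expr1n K 2).
  by rewrite scale1r mul1r => *; exists act.
have N1_sq : (-1) ^+ 2 = 1 :> K by rewrite sqrrN expr1n.
have [act [actP []]] := twisted_algA_module char0 i2 rhoP N1_sq.
by rewrite scaleN1r mulN1r opprK => *; exists act.
Qed.
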